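(* Let $G$ be an affine algebraic group over $\Bbbk$, let $H=G^0$ be its identity component, and let $g\in G$. If the connected component $gH$ is periodic, then all elements of $gH$ have the same order.
   Context: $\Bbbk$ is an algebraically closed field of characteristic zero. A connected component of an affine algebraic group is called periodic if all its elements have finite order. *)

(* Defs.v *)
From HB Require Import structures.
From mathcomp Require Import all_boot all_algebra.
From mathcomp Require Import mpoly.
From mathcomp Require Import boolp classical_sets topology.

Set Implicit Arguments.
Unset Strict Implicit.
Unset Printing Implicit Defensive.

Import GRing.Theory.
Local Open Scope ring_scope.
Local Open Scope classical_set_scope.

(* The type of K-points of affine n-space. It is an alias of 'rV[K]_n so that
   the Zariski topology below does not interfere with the product topology that
   the library puts on matrices over a topological ring. *)
Definition affine_space (K : closedFieldType) (n : nat) : Type := 'rV[K]_n.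

HB.instance Definition _ (K : closedFieldType) n :=
  Choice.copy (affine_space K n) 'rV[K]_n.

Definition peval (K : closedFieldType) n (p : {mpoly K[n]})
  (x : affine_space K n) : K := p.@[(x : 'rV[K]_n) 0].

Definition zero_locus (K : closedFieldType) n (S : set {mpoly K[n]}) :
  set (affine_space K n) := [set x | forall p, S p -> peval p x = 0].

Definition zariski_open (K : closedFieldType) n (U : set (affine_space K n)) :=
  exists S, ~` U = zero_locus S.

Section ZariskiTopology.
Variables (K : closedFieldType) (n : nat).

Let zopen := @zariski_open K n.

Lemma zariski_openT : zopen setT.
Proof.
exists setT; rewrite setCT; apply/seteqP; split=> // x /(_ 1 I).
by rewrite /peval rmorph1 => /eqP; rewrite oner_eq0.
Qed.

Lemma zariski_openI : setI_closed zopen.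
Proof.
move=> U V [S US] [T VT].
exists [set r | exists p q, [/\ S p, T q & r = p * q]].
rewrite setCI US VT; apply/seteqP; split=> x /=.
  move=> [Sx|Tx] _ [p [q [Sp Tq ->]]]; rewrite /peval mevalM.
    by have := Sx _ Sp; rewrite /peval => ->; rewrite mul0r.
  by have := Tx _ Tq; rewrite /peval => ->; rewrite mulr0.
move=> STx; have [Sx|/existsNP[p /not_implyP[Sp px]]] :=
  pselect (forall p, S p -> peval p x = 0); first by left.
right=> q Tq; have /eqP : peval (p * q) x = 0 by apply: STx; exists p, q.
by rewrite /peval mevalM mulf_eq0 => /orP[/eqP //|/eqP].
Qed.

Lemma zariski_open_bigcup (I : Type) (f : I -> set (affine_space K n)) :
  (forall i, zopen (f i)) -> zopen (\bigcup_i f i).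
Proof.
move=> fo; exists [set p | forall x, (~` \bigcup_i f i) x -> peval p x = 0].
apply/seteqP; split=> x /=; first by move=> nx p; apply.
move=> zx [i _ fix_]; have [S fS] := fo i.
suff : (~` f i) x by [].
rewrite fS => p Sp; apply: zx => y ny.
have : (~` f i) y by move=> fiy; apply: ny; exists i.
by rewrite fS; apply.
Qed.

HB.instance Definition _ := isOpenTopological.Build (affine_space K n)
  zariski_openT zariski_openI zariski_open_bigcup.

Lemma zariski_closedP (Z : set (affine_space K n)) :
  closed Z <-> exists S, Z = zero_locus S.
Proof.
rewrite -openC; split=> -[S ZS]; exists S; last by rewrite setCK.
by rewrite -ZS setCK.
Qed.

End ZariskiTopology.

(* [f] is a regular function on [T], where [T] is viewed as a subset of affine
   space through [phi]. *)
Definition regular_function (K : closedFieldType) n (T : Type)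
    (phi : T -> affine_space K n) (f : T -> K) :=
  exists p : {mpoly K[n]}, forall t, f t = peval p (phi t).

(* An affine algebraic group, identified with its group of K-points: a group
   whose underlying set is identified with a Zariski closed subset of some
   affine space in such a way that multiplication G * G -> G and inversion
   G -> G are morphisms of affine varieties. *)
HB.mixin Record isAffineAlgebraic (K : closedFieldType) G & Group G := {
  adim : nat;
  acoord : G -> affine_space K adim;
  acoord_inj : injective acoord;
  acoord_closed : closed (range acoord);
  acoord_mul : forall i : 'I_adim,
    regular_function (fun xy : G * G => row_mx (acoord xy.1) (acoord xy.2)
                               : affine_space K (adim + adim))
            (fun xy : G * G => acoord (xy.1 * xy.2)%g 0 i);
  acoord_inv : forall i : 'I_adim,
    regular_function acoord (fun x : G => acoord (x^-1)%g 0 i)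
}.

#[short(type="affineAlgGroupType")]
HB.structure Definition AffineAlgGroup (K : closedFieldType) :=
  { G of isAffineAlgebraic K G & Group G }.

(* The connected component of 1 in G for the Zariski topology induced by
   [acoord]. *)
Definition identity_component (K : closedFieldType)
    (G : affineAlgGroupType K) : set G :=
  @acoord K G @^-1` connected_component (range (@acoord K G)) (acoord 1%g).

Arguments identity_component {K} G.

Definition left_coset (G : groupType) (g : G) (H : set G) : set G :=
  [set (g * h)%g | h in H].

Definition finite_order (G : groupType) (x : G) :=
  exists m : nat, (0 < m)%N && (x ^+ m == 1)%g.

(* By convention the order is 0 for elements of infinite order. *)
Definition elt_order (G : groupType) (x : G) : nat :=
  if pselect (finite_order x) is left fx then ex_minn fx else 0%N.

Lemma elt_orderP (G : groupType) (x : G) (d : nat) : finite_order x ->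
  elt_order x = d <->
  [/\ (0 < d)%N, (x ^+ d = 1)%g
    & forall m, (0 < m)%N -> (x ^+ m = 1)%g -> (d <= m)%N].
Proof.
move=> fx; rewrite /elt_order; case: pselect => // fx'.
case: ex_minnP => m /andP[m0 /eqP xm] mmin; split=> [<-|[d0 xd dmin]].
  by split=> // k k0 xk; apply: mmin; rewrite k0 xk eqxx.
by apply/eqP; rewrite eqn_leq dmin// mmin// d0 xd eqxx.
Qed.

Definition periodic (G : groupType) (C : set G) :=
  forall x, C x -> finite_order x.

(* Main.v *)
Require Import Defs.
From mathcomp Require Import all_boot all_order all_algebra all_solvable all_field.
From mathcomp Require Import mpoly.
From mathcomp Require Import boolp classical_sets topology.

(* Embed G in GL_m and let z have finite order. In characteristic zero the
   matrix of z is diagonalizable, so its trace is a sum of m roots of unity;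
   such a sum can equal a natural number N only if N <= m, and it equals m only
   if z = 1. On a periodic component gH the regular function
   h |-> tr ((g h) ^+ d) thus misses all natural numbers larger than m. Its
   image is constructible, hence finite or cofinite, hence finite, and it is
   constant because H is connected. So x ^+ d = 1 holds for all x in gH or for
   none. *)

Set Implicit Arguments.
Unset Strict Implicit.
Unset Printing Implicit Defensive.

Import Order.TTheory GRing.Theory Num.Theory.
Local Open Scope ring_scope.
Local Open Scope classical_set_scope.

(** * Noetherian rings *)

Definition is_ideal (R : comNzRingType) (I : set R) :=
  [/\ I 0, forall x y, I x -> I y -> I (x + y) & forall a x, I x -> I (a * x)].

(** Finite generation is encoded by minimality: every ideal containing [s] contains [I]. This avoids
    explicit linear combinations. *)
Definition noetherian (R : comNzRingType) :=
  forall I : set R, is_ideal I -> exists s : seq R,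
    [set` s] `<=` I /\ forall J, is_ideal J -> [set` s] `<=` J -> I `<=` J.

Lemma noetherian_field (K : fieldType) : noetherian K.
Proof.
move=> I [I0 _ IM]; have [[u [Iu u0]]|noU] := pselect (exists u, I u /\ u != 0).
  exists [:: u]; split=> [x /=|J [_ _ JM] /(_ u) Ju x _].
    by rewrite inE => /eqP ->.
  rewrite -(divfK u0 x); apply: JM; apply: Ju.
  by rewrite /= inE.
exists [::]; split=> [x|J [J0 _ _] _ x Ix]; first by rewrite /= in_nil.
have [->//|x0] := eqVneq x 0; by case: noU; exists x.
Qed.

Lemma noetherian_surj (R S : comNzRingType) (f : {rmorphism R -> S}) :
  (forall y, exists x, f x = y) -> noetherian R -> noetherian S.
Proof.
move=> fsurj nR I [I0 ID IM].
have preim_ideal J : is_ideal J -> is_ideal (f @^-1` J).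
  move=> [J0 JD JM]; split=> [|x y|a x] /=; rewrite ?rmorph0 ?rmorphD ?rmorphM //.
  - exact: JD.
  - exact: JM.
have [s [sI sgen]] := nR _ (preim_ideal I (And3 I0 ID IM)).
exists (map f s); split=> [y /= /mapP[x xs ->]|J Jid sJ y Iy].
  exact: (sI x).
have [x fxy] := fsurj y; rewrite -fxy.
apply: (sgen _ (preim_ideal J Jid)); last by rewrite /= fxy.
by move=> z zs; apply: sJ; rewrite /= map_f.
Qed.

(** Bounding the size instead of fixing the degree admits 0, so that an ideal [I] yields an
    ideal. *)
Definition lead_coefs (R : comNzRingType) (I : set {poly R}) (d : nat) : set R :=
  [set a | exists2 f, I f & (size f <= d.+1)%N /\ f`_d = a].

Section LeadCoefs.
Variables (R : comNzRingType) (I : set {poly R}).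
Hypothesis idI : is_ideal I.

Lemma lead_coefs_le d e : (d <= e)%N -> lead_coefs I d `<=` lead_coefs I e.
Proof.
move=> de a [f If [szf fd]]; have [_ _ IM] := idI; exists ('X^(e - d) * f).
  exact: IM.
split; last by rewrite coefXnM ltnNge leq_subr /= subKn.
apply: leq_trans (size_polyMleq _ _) _; rewrite size_polyXn addSn /=.
by apply: leq_trans (leq_add (leqnn _) szf) _; rewrite addnS subnK.
Qed.

Lemma lead_coefs_ideal d : is_ideal (lead_coefs I d).
Proof.
have [I0 ID IM] := idI; split=> [|a b [f If [sf <-]] [g Ig [sg <-]]|a b [f If [sf <-]]].
- by exists 0; rewrite ?size_poly0 ?coef0.
- exists (f + g); first exact: ID.
  split; last by rewrite coefD.
  by apply: leq_trans (size_polyD _ _) _; rewrite geq_max sf sg.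
- exists (a%:P * f); first exact: IM.
  split; last by rewrite coefCM.
  by rewrite mul_polyC; apply: leq_trans (size_scale_leq _ _) sf.
Qed.

Lemma lead_coefs_bigcup_ideal : is_ideal (\bigcup_d lead_coefs I d).
Proof.
split=> [|a b [d _ ad] [e _ be]|a b [d _ bd]].
- by exists 0%N => //; case: (lead_coefs_ideal 0).
- exists (maxn d e) => //; case: (lead_coefs_ideal (maxn d e)) => _ + _; apply.
    by apply: lead_coefs_le ad; apply: leq_maxl.
  by apply: lead_coefs_le be; apply: leq_maxr.
- by exists d => //; case: (lead_coefs_ideal d) => _ _; apply.
Qed.

(** Lifts finitely many leading coefficients to elements of [I]. The form with an arbitrary [J]
    containing the lifts serves to compare [I] with its intersection with [J], degree by degree. *)
Lemma lead_coefs_witness d (s : seq R) : [set` s] `<=` lead_coefs I d ->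
  exists t : seq {poly R}, [set` t] `<=` I /\
    forall J, is_ideal J -> [set` t] `<=` J -> [set` s] `<=` lead_coefs (I `&` J) d.
Proof.
elim: s => [|a s IHs] sI; first by exists [::]; split=> // x.
have [t [tI tJ]] : exists t : seq {poly R}, [set` t] `<=` I /\
    forall J, is_ideal J -> [set` t] `<=` J -> [set` s] `<=` lead_coefs (I `&` J) d.
  by apply: IHs => x xs; apply: sI; rewrite /= inE xs orbT.
have [f If fa] : lead_coefs I d a by apply: sI; rewrite /= inE eqxx.
exists (f :: t); split=> [g /=|J Jid ftJ b /=]; rewrite inE => /orP[/eqP->|] //.
- exact: tI.
- by exists f => //; split=> //; apply: ftJ; rewrite /= inE eqxx.
- by apply: tJ => // g gt; apply: ftJ; rewrite /= inE gt orbT.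
Qed.

End LeadCoefs.

Lemma is_idealI (R : comNzRingType) (I J : set R) :
  is_ideal I -> is_ideal J -> is_ideal (I `&` J).
Proof.
move=> [I0 ID IM] [J0 JD JM]; split=> [//|x y [? ?] [? ?]|a x [? ?]].
  by split; [apply: ID|apply: JD].
by split; [apply: IM|apply: JM].
Qed.

(** Hilbert's basis theorem. If [I] and its intersection with [J] have the same leading coefficients
    in each degree, cancelling leading terms puts [I] inside [J]. Lifts for the union of all leading
    ideals settle the degrees from [D] on; each lower degree gets its own lifts. *)
Theorem noetherian_poly (R : comNzRingType) : noetherian R -> noetherian {poly R}.
Proof.
move=> nR I Iid.
have [s [sI sgen]] := nR _ (lead_coefs_bigcup_ideal Iid).
have [D sD] : exists D, [set` s] `<=` lead_coefs I D.
  elim: s sI {sgen} => [|a s IHs] sI; first by exists 0%N => x.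
  have [|D sD] := IHs; first by move=> x xs; apply: sI; rewrite /= inE xs orbT.
  have [e _ ae] : (\bigcup_d lead_coefs I d) a by apply: sI; rewrite /= inE eqxx.
  exists (maxn e D) => x /=; rewrite inE => /orP[/eqP->|xs].
    exact: (lead_coefs_le Iid (leq_maxl e D)).
  exact: (lead_coefs_le Iid (leq_maxr e D) (sD x xs)).
have [t [tI tJ]] := lead_coefs_witness sD.
have [u [uI uJ]] : exists u : seq {poly R}, [set` u] `<=` I /\
    forall J, is_ideal J -> [set` u] `<=` J ->
      forall d, (d < D)%N -> lead_coefs I d `<=` lead_coefs (I `&` J) d.
  elim: (D) => [|E [u [uI uJ]]]; first by exists [::]; split=> // x.
  have [r [rI rgen]] := nR _ (lead_coefs_ideal Iid E).
  have [v [vI vJ]] := lead_coefs_witness rI.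
  exists (u ++ v); split=> [f /=|J Jid uvJ d].
    by rewrite mem_cat => /orP[/uI|/vI].
  rewrite ltnS leq_eqVlt => /orP[/eqP ->|dE].
    apply: rgen; first exact/lead_coefs_ideal/is_idealI.
    by apply: vJ => // f fv; apply: uvJ; rewrite /= mem_cat (fv : f \in v) orbT.
  by apply: uJ => // f fu; apply: uvJ; rewrite /= mem_cat (fu : f \in u).
exists (t ++ u); split=> [f /=|J Jid tuJ].
  by rewrite mem_cat => /orP[/tI|/uI].
have IJid := is_idealI Iid Jid.
have leadIJ d : lead_coefs I d `<=` lead_coefs (I `&` J) d.
  have [dD|Dd] := ltnP d D.
    by apply: uJ => // f fu; apply: tuJ; rewrite /= mem_cat (fu : f \in u) orbT.
  apply: (@subset_trans _ (\bigcup_d lead_coefs I d)).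
    by move=> x xd; exists d.
  apply: sgen; first exact: lead_coefs_ideal.
  apply: subset_trans (lead_coefs_le IJid Dd).
  by apply: tJ => // f ft; apply: tuJ; rewrite /= mem_cat (ft : f \in t).
(* For [f] nonzero, subtracting an element [g] of both ideals with the same leading term lowers the
   size. *)
move=> f; have [n] := ubnP (size f); elim: n f => // n IHn f szf If.
have [->|f0] := eqVneq f 0; first by case: Jid.
have szf' : (size f).-1.+1 = size f by rewrite prednK // size_poly_gt0.
have [|g [Ig Jg] [szg gf]] := @leadIJ (size f).-1 (lead_coef f).
  by exists f; rewrite // szf'.
have [_ ID IM] := Iid; have [_ JD JM] := Jid.
rewrite -[f](subrK g); apply: JD => //; apply: IHn.
  have : (size (f - g)%R <= (size f).-1)%N.
    apply/leq_sizeP => j; rewrite leq_eqVlt => /orP[/eqP<-|ltj].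
      by rewrite coefB gf subrr.
    rewrite coefB !nth_default ?subr0 //; first exact: leq_trans szg ltj.
    by rewrite -szf'.
  by move/leq_ltn_trans; apply; rewrite szf' -ltnS.
by apply: ID => //; rewrite -mulN1r; apply: IM.
Qed.

Lemma mpoly_ring_ind (R : comNzRingType) n (P : {mpoly R[n]} -> Prop) :
  (forall c, P c%:MP) -> (forall i, P 'X_i) ->
  (forall p q, P p -> P q -> P (p + q)) ->
  (forall p q, P p -> P q -> P (p * q)) -> forall p, P p.
Proof.
move=> PC PX PD PM p; rewrite (mpolyE p).
elim/big_ind: _ => [|? ? ? ?|m _]; [by rewrite -mpolyC0|exact: PD|].
rewrite -mul_mpolyC; apply: (PM) => //; rewrite mpolyXE_id.
elim/big_ind: _ => [|? ? ? ?|i _]; [by rewrite -mpolyC1|exact: PM|].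
elim: (m i) => [|k IHk]; first by rewrite expr0 -mpolyC1.
by rewrite exprS; apply: PM.
Qed.

Theorem noetherian_mpoly (K : fieldType) n : noetherian {mpoly K[n]}.
Proof.
elim: n => [|n IHn].
  apply: (@noetherian_surj _ _ (@mpolyC 0 K)); last exact: noetherian_field.
  by elim/mpoly_ring_ind => [c|[]|p q [a <-] [b <-]|p q [a <-] [b <-]] //;
    [exists c|exists (a + b); rewrite rmorphD|exists (a * b); rewrite rmorphM].
(* Evaluation at the last variable maps the polynomials over [{mpoly K[n]}] onto [{mpoly
   K[n.+1]}]. *)
have cX : commr_rmorph (@mwiden n K) 'X_ord_max by move=> p; apply: mulrC.
apply: (@noetherian_surj _ _ (horner_morph cX)); last exact: noetherian_poly.
elim/mpoly_ring_ind => [c|i|p q [a <-] [b <-]|p q [a <-] [b <-]].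
- by exists (c%:MP%:P); rewrite /= horner_morphC /= mwidenC.
- have [j ->|->] := unliftP ord_max i.
    exists ('X_j)%:P; rewrite /= horner_morphC /= mwidenX mnmwiden1.
    by congr 'X__; apply/val_inj; rewrite /= /bump leqNgt ltn_ord.
  by exists 'X; rewrite /= horner_morphX.
- by exists (a + b); rewrite rmorphD.
- by exists (a * b); rewrite rmorphM.
Qed.

(** * Images of regular functions *)

Lemma zero_locus_fin (K : closedFieldType) n (Z : set (affine_space K n)) :
  closed Z -> exists s : seq {mpoly K[n]}, Z = zero_locus [set` s].
Proof.
move=> /zariski_closedP[S ->].
have vid (T : set (affine_space K n)) :
    is_ideal [set p : {mpoly K[n]} | forall x, T x -> peval p x = 0].
  split=> [x _|p q p0 q0 x Tx|a p p0 x Tx]; rewrite /peval.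
  - by rewrite meval0.
  - by rewrite mevalD [X in X + _]p0 // [X in _ + X]q0 // addr0.
  - by rewrite mevalM [X in _ * X]p0 // mulr0.
have [s [sS sgen]] := noetherian_mpoly (vid (zero_locus S)).
exists s; apply/seteqP; split=> x Zx p ps; first exact: (sS p).
(* The polynomials vanishing on the zero locus of [s] form an ideal containing [s], hence containing
   [S]. *)
by have /(_ p) := sgen _ (vid _) (fun q qs y Zy => Zy q qs); apply => // y; apply.
Qed.

(** * First-order formulas and quantifier elimination *)

Lemma mpoly_term (K : closedFieldType) n (p : {mpoly K[n]}) :
  exists2 t : GRing.term K, GRing.rterm t &
    forall e, GRing.eval e t = p.@[fun i : 'I_n => e`_i].
Proof.
elim/mpoly_ring_ind: p => [c|i|p q [t rt te] [u ru ue]|p q [t rt te] [u ru ue]].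
- by exists (c%:T)%T => // e; rewrite mevalC.
- by exists ('X_i)%T => // e; rewrite mevalXU.
- by exists (t + u)%T => [|e] /=; rewrite ?rt // te ue mevalD.
- by exists (t * u)%T => [|e] /=; rewrite ?rt // te ue mevalM.
Qed.

Lemma holds_exists_seq (K : closedFieldType) (s : seq nat) (f : GRing.formula K) e :
  GRing.holds e (foldr GRing.Exists f s) <->
  exists2 e', forall i, i \notin s -> e'`_i = e`_i & GRing.holds e' f.
Proof.
elim: s e => [|i s IHs] e /=.
  split=> [ef|[e' ee' e'f]]; first by exists e.
  by apply: GRing.eq_holds e'f => i; apply: ee'.
split=> [[x /IHs[e' ee' e'f]]|[e' ee' e'f]].
  exists e' => // j; rewrite inE negb_or => /andP[ji js].
  by rewrite ee' // nth_set_nth /= (negPf ji).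
exists e'`_i; apply/IHs; exists e' => // j js.
rewrite nth_set_nth /=; have [->//|ji] := eqVneq j i.
by rewrite ee' // inE negb_or ji js.
Qed.

Section OneVariable.
Variables (K : closedFieldType) (n : nat).
(** Variable [n] carries [c]; all others read 0, from the list or by default, so a term becomes a
    polynomial in [c]. *)
Let env (c : K) := rcons (nseq n 0) c.

Let term_poly (t : GRing.term K) : GRing.rterm t ->
  exists P : {poly K}, forall c, GRing.eval (env c) t = P.[c].
Proof.
elim: t => //= [i _|c _|k _|t IHt u IHu|t IHt|t IHt k|t IHt u IHu|t IHt k].
- exists (if i == n then 'X else 0) => c.
  rewrite nth_rcons size_nseq nth_nseq; case: ltngtP => _; rewrite ?horner0 //.
  by rewrite hornerX.
- by exists c%:P => d; rewrite hornerC.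
- by exists k%:R%:P => d; rewrite hornerC.
- by move=> /andP[/IHt[P tP] /IHu[Q uQ]]; exists (P + Q) => c; rewrite hornerD tP uQ.
- by move=> /IHt[P tP]; exists (- P) => c; rewrite hornerN tP.
- by move=> /IHt[P tP]; exists (P *+ k) => c; rewrite hornerMn tP.
- by move=> /andP[/IHt[P tP] /IHu[Q uQ]]; exists (P * Q) => c; rewrite hornerM tP uQ.
- by move=> /IHt[P tP]; exists (P ^+ k) => c; rewrite horner_exp tP.
Qed.

(** An equation [P = Q] is an identity or holds only at the finitely many roots of [P - Q];
    connectives merge the exceptional sets. *)
Lemma qf_eval_cofinite (f : GRing.formula K) :
  GRing.qf_form f && GRing.rformula f ->
  exists (s : seq K) (b : bool), forall c, c \notin s -> GRing.qf_eval (env c) f = b.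
Proof.
elim: f => //= [b _|t u|f IHf g IHg|f IHf g IHg|f IHf g IHg|f IHf].
- by exists [::], b.
- move=> /andP[/term_poly[P tP] /term_poly[Q uQ]].
  have [PQ|PQ] := eqVneq P Q.
    by exists [::], true => c _; rewrite tP uQ PQ eqxx.
  have [r Dr] := closed_field_poly_normal (P - Q).
  exists r, false => c; apply: contraNF; rewrite tP uQ -subr_eq0.
  move=> PQc; rewrite -root_prod_XsubC.
  rewrite -(rootZ _ (a := lead_coef (P - Q))) ?lead_coef_eq0 ?subr_eq0 //.
  by rewrite -Dr rootE hornerD hornerN.
all: rewrite 1?andbACA; try move=> /andP[/IHf[s [b sb]] /IHg[s' [b' sb']]].
- exists (s ++ s'), (b && b') => c; rewrite mem_cat negb_or => /andP[cs cs'].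
  by rewrite sb // sb'.
- exists (s ++ s'), (b || b') => c; rewrite mem_cat negb_or => /andP[cs cs'].
  by rewrite sb // sb'.
- exists (s ++ s'), (b ==> b') => c; rewrite mem_cat negb_or => /andP[cs cs'].
  by rewrite sb // sb'.
- by move=> /IHf[s [b sb]]; exists s, (~~ b) => c /sb ->.
Qed.

End OneVariable.

(** Chevalley's theorem for maps to the affine line: the image is defined by an existential formula,
    and elimination leaves a quantifier-free condition on [c], constant off a finite set. *)
Theorem image_finite_or_cofinite (K : closedFieldType) n
    (Z : set (affine_space K n)) (f : {mpoly K[n]}) : closed Z ->
  exists s : seq K, (forall x, Z x -> peval f x \in s) \/
    (forall c, c \notin s -> exists2 x, Z x & peval f x = c).
Proof.
move=> /zero_locus_fin[ps ->].
have [tf rtf tfP] := mpoly_term f.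
(* Variables below [n] hold the point, variable [n] the value of [f]. *)
have [phi rphi phiP] : exists2 phi : GRing.formula K, GRing.rformula phi &
    forall e, GRing.holds e phi <->
      zero_locus [set` ps] (\row_i e`_i) /\ f.@[fun i : 'I_n => e`_i] = e`_n.
  have [psi rpsi psiP] : exists2 phi : GRing.formula K, GRing.rformula phi &
      forall e, GRing.holds e phi <-> zero_locus [set` ps] (\row_i e`_i).
    elim: ps => [|p ps [psi rpsi psiP]].
      by exists (GRing.Bool true) => // e; split=> // _ p.
    have [t rt tP] := mpoly_term p.
    exists (GRing.And (GRing.Equal t (GRing.NatConst _ 0)) psi) => [|e] /=.
      by rewrite rt.
    have -> : GRing.eval e t = peval p (\row_i e`_i).
      by rewrite tP; apply: meval_eq => i; rewrite mxE.
    rewrite psiP; split=> [[p0 ps0] q /=|pps0].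
      by rewrite inE => /orP[/eqP->|/ps0].
    split; first by apply: (pps0 p); rewrite /= inE eqxx.
    by move=> q qps; apply: pps0; rewrite /= inE (qps : q \in ps) orbT.
  exists (GRing.And psi (GRing.Equal tf (GRing.Var _ n))) => [|e] /=.
    by rewrite rpsi rtf.
  by rewrite psiP tfP.
pose Phi := foldr GRing.Exists phi (iota 0 n).
have rPhi : GRing.rformula Phi by rewrite /Phi; elim: (iota 0 n).
have solK := @solve_monicpoly K.
have wf := ClosedFieldQE.wf_ex_elim (F := K).
have ok := ClosedFieldQE.holds_ex_elim solK.
have [s [b sb]] := qf_eval_cofinite n (GRing.quantifier_elim_wf wf rPhi).
have PhiP c : (exists2 x, zero_locus [set` ps] x & peval f x = c) <->
    GRing.holds (rcons (nseq n 0) c) Phi.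
  rewrite holds_exists_seq; split=> [[x Zx fx]|[e ec /phiP[Ze fe]]].
    pose xs := rcons [seq (x : 'rV[K]_n) 0 i | i <- enum 'I_n] c.
    have szx : size [seq (x : 'rV[K]_n) 0 i | i <- enum 'I_n] = n.
      by rewrite size_map size_enum_ord.
    have xsi (i : 'I_n) : xs`_i = (x : 'rV[K]_n) 0 i.
      by rewrite nth_rcons szx ltn_ord (nth_map i) ?size_enum_ord ?nth_ord_enum.
    have xsn : xs`_n = c by rewrite nth_rcons szx ltnn eqxx.
    exists xs => [i|].
      rewrite mem_iota add0n -leqNgt => ni.
      by rewrite !nth_rcons szx size_nseq ltnNge ni.
    apply/phiP; rewrite xsn -fx; split; last by apply: meval_eq.
    suff -> : \row_i xs`_i = x :> 'rV_n by [].
    by apply/rowP => i; rewrite mxE xsi.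
  have en : e`_n = c.
    by rewrite ec ?mem_iota ?ltnn ?andbF // nth_rcons size_nseq ltnn eqxx.
  exists (\row_i e`_i); rewrite // -en -fe.
  by apply: meval_eq => i; rewrite mxE.
exists s; case: b sb => sb; [right=> c cs|left=> x Zx].
  by apply/PhiP/(GRing.quantifier_elim_rformP wf ok _ rPhi); rewrite sb.
apply: contraT => /sb/negbT/(GRing.quantifier_elim_rformP wf ok _ rPhi) [].
by apply/PhiP; exists x.
Qed.

(** * Regular functions on connected closed sets *)

Lemma natr_inj (R : idomainType) : [pchar R] =i pred0 ->
  injective (fun n : nat => n%:R : R).
Proof.
move=> charR m n; wlog mn : m n / (m <= n)%N => [wl|].
  by have [/wl//|/ltnW/wl nm /esym/nm/esym] := leqP m n.
move=> /esym/eqP; rewrite -subr_eq0 -natrB // ((pcharf0P R).1 charR) subn_eq0 => nm.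
by apply/eqP; rewrite eqn_leq mn nm.
Qed.

(** A level set is closed in [Z], and so is its complement, the zero locus of [q], because only
    finitely many values occur. Connectedness leaves one level set. *)
Lemma connected_finite_range (K : closedFieldType) n
    (Z : set (affine_space K n)) (f : {mpoly K[n]}) (s : seq K) :
  connected Z -> (forall x, Z x -> peval f x \in s) ->
  forall x y, Z x -> Z y -> peval f x = peval f y.
Proof.
move=> conZ fs x y Zx Zy; apply: esym.
suff fx : Z `&` [set z | peval f z = peval f x] = Z by move: Zy; rewrite -{1}fx => -[].
pose q := \prod_(c <- s | c != peval f x) (f - c%:MP).
have pq z : peval q z = \prod_(c <- s | c != peval f x) (peval f z - c).
  rewrite /peval /q rmorph_prod /=; apply: eq_bigr => c _.
  by rewrite mevalB mevalC.
apply: conZ; first by exists x.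
  exists (~` zero_locus [set q]).
    by apply: closed_openC; apply/zariski_closedP; exists [set q].
  apply/seteqP; split=> z [Zz] fz; split=> //=.
    move=> /(_ q erefl); rewrite pq fz => /eqP; apply/negP.
    by rewrite prodf_seq_neq0; apply/allP => c _; apply/implyP; rewrite subr_eq0 eq_sym.
  apply/eqP/negPn/negP => fzx; apply: fz => _ -> /=; rewrite pq.
  apply/eqP; rewrite prodf_seq_eq0; apply/hasP; exists (peval f z).
    exact: fs.
  by rewrite fzx subrr /=.
exists (zero_locus [set f - (peval f x)%:MP]).
  by apply/zariski_closedP; exists [set f - (peval f x)%:MP].
apply/seteqP; split=> z [Zz] fz; split=> //=.
  by move=> _ ->; rewrite /peval mevalB mevalC [X in X - _]fz subrr.
have := fz _ erefl; rewrite /peval mevalB mevalC => /eqP.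
by rewrite subr_eq0 => /eqP.
Qed.

(* A non-constant regular function omits finitely many values only, hence takes
   arbitrarily large natural numbers as values. *)
Lemma connected_bounded_nat_values (K : closedFieldType) n
    (Z : set (affine_space K n)) (f : {mpoly K[n]}) (b : nat) :
  [pchar K] =i pred0 -> closed Z -> connected Z ->
  (forall x N, Z x -> peval f x = N%:R -> (N <= b)%N) ->
  forall x y, Z x -> Z y -> peval f x = peval f y.
Proof.
move=> charK clZ conZ fb.
have [s [fs|fs]] := image_finite_or_cofinite f clZ.
  exact: connected_finite_range fs.
suff [N bN Ns] : exists2 N, (b < N)%N & N%:R \notin s.
  have [x Zx /(fb _ _ Zx)] := fs _ Ns.
  by rewrite leqNgt bN.
(* Pigeonhole: the [(size s).+1] naturals following [b] are distinct in [K], so they cannot all lie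
   in [s]. *)
have [|/hasPn noN] := boolP (has (fun N => N%:R \notin s) (iota b.+1 (size s).+1)).
  by move=> /hasP[N]; rewrite mem_iota => /andP[bN _] Ns; exists N.
have := @uniq_leq_size _ [seq N%:R : K | N <- iota b.+1 (size s).+1] s.
rewrite map_inj_uniq ?iota_uniq; last exact: natr_inj.
rewrite size_map size_iota ltnn => /(_ isT) sub; suff : false by [].
by apply: sub => _ /mapP[N /noN /negPn Ns ->].
Qed.

(** * Traces of matrices of finite order *)

Lemma intr_eq0_pchar0 (K : fieldType) (a : int) : [pchar K] =i pred0 ->
  (a%:~R == 0 :> K) = (a == 0).
Proof.
move=> charK; case: a => k; first exact: ((pcharf0P K).1 charK).
by rewrite NegzE mulrNz !oppr_eq0; apply: ((pcharf0P K).1 charK).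
Qed.

Lemma prim_root_exists (K : closedFieldType) e : [pchar K] =i pred0 ->
  (0 < e)%N -> exists z : K, e.-primitive_root z.
Proof.
move=> charK e0; have [r Dp] := closed_field_poly_normal ('X^e - 1 : {poly K}).
rewrite (monicP _) ?monicXnsubC // scale1r in Dp.
have rn1 : all e.-unity_root r by apply/allP=> z; rewrite -root_prod_XsubC -Dp.
have sz_r : (e < (size r).+1)%N.
  by rewrite -(size_prod_XsubC r id) -Dp size_XnsubC.
have [|z] := hasP (has_prim_root e0 rn1 _ sz_r); last by exists z.
rewrite -separable_prod_XsubC -Dp separable_Xn_sub_1 //.
by rewrite ((pcharf0P K).1 charK) -lt0n.
Qed.

(** ['X^e - 1] is the product of the ['Phi_d] with [d] dividing [e], so [z] is a root of one of
    them; then [z ^+ d = 1] forces [e] to divide [d]. *)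
Lemma Cyclotomic_prim_root (K : fieldType) e (z : K) :
  e.-primitive_root z -> root (map_poly intr 'Phi_e) z.
Proof.
move=> zprim; have e0 := prim_order_gt0 zprim.
have : root (map_poly intr ('X^e - 1)) z.
  by rewrite rmorphB rmorph1 /= map_polyXn rootE !hornerE prim_expr_order // subrr.
rewrite -prod_Cyclotomic // rmorph_prod /= rootE horner_prod prodf_seq_eq0.
move=> /hasP[d]; rewrite -dvdn_divisors // => de; rewrite /= => dz.
suff -> : e = d by [].
apply/eqP; rewrite eqn_dvd de andbT (prim_order_dvd zprim).
have d0 : (0 < d)%N by apply: dvdn_gt0 de.
have : root (map_poly intr ('X^d - 1)) z.
  rewrite -prod_Cyclotomic // rmorph_prod /= rootE horner_prod prodf_seq_eq0.
  by apply/hasP; exists d; rewrite -?dvdn_divisors.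
by rewrite rmorphB rmorph1 /= map_polyXn rootE !hornerE subr_eq0.
Qed.

(** Carries an integral relation from [K] to [algC], where absolute values exist. The resultant of
    [q] and ['Phi_e] is a combination of both, so its image in [K] is 0; in characteristic zero the
    integer itself is 0, and the resulting common factor has a root in [algC]. *)
Lemma prim_root_transfer (K : fieldType) e (z : K) (q : {poly int}) :
  [pchar K] =i pred0 -> e.-primitive_root z -> root (map_poly intr q) z ->
  exists2 w : algC, e.-primitive_root w & root (map_poly intr q) w.
Proof.
move=> charK zprim qz; have e0 := prim_order_gt0 zprim.
have [w0 w0prim] := C_prim_root_exists e0.
(* The resultant identity is for non-constant polynomials; a constant [q] with a root is 0, and then
   any primitive root serves. *)
have [q1|q1] := leqP (size q) 1.
  exists w0 => //; move: qz; rewrite (size1_polyC q1) map_polyC /= rootC.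
  by rewrite intr_eq0_pchar0 // => /eqP ->; rewrite polyC0 map_poly0 root0.
have Phi1 : (1 < size 'Phi_e)%N by rewrite size_Cyclotomic ltnS totient_gt0.
have [[u v] /= _ uv] := resultant_in_ideal q1 Phi1.
have : resultant q 'Phi_e == 0.
  rewrite -(intr_eq0_pchar0 _ charK).
  have /(congr1 (fun p => (map_poly intr p).[z])) := uv.
  rewrite map_polyC hornerC /= => ->.
  rewrite rmorphD !rmorphM /= hornerD !hornerM (rootP qz).
  by rewrite (rootP (Cyclotomic_prim_root zprim)) !mulr0 addr0.
rewrite resultant_eq0 => szg.
have [w gw] : exists w : algC, root (map_poly intr (gcdp q 'Phi_e)) w.
  apply/closed_rootP; rewrite size_map_inj_poly //; first by rewrite gtn_eqF.
  exact: intr_inj.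
(* Divisibility over the integers here means divisibility up to a nonzero factor [c]. *)
have dvd_root p : gcdp q 'Phi_e %| p -> root (map_poly intr p) w.
  move=> /Pdiv.Idomain.dvdpP[[c r] /= c0 /(congr1 (map_poly (intr : int -> algC)))].
  rewrite map_polyZ rmorphM /= => /(congr1 (root^~ w)).
  by rewrite rootM gw orbT rootZ ?intr_eq0.
exists w; last exact/dvd_root/dvdp_gcdl.
rewrite -(root_cyclotomic w0prim) -(Cintr_Cyclotomic w0prim).
exact/dvd_root/dvdp_gcdr.
Qed.

Section SumOfRootsOfUnity.
Variables (K : closedFieldType) (charK : [pchar K] =i pred0).
Variables (m e : nat) (x : 'I_m -> K).
Hypotheses (e_gt0 : (0 < e)%N) (xe : forall i, x i ^+ e = 1).

(** With [x i = z ^+ k i] the equation is an integral relation on [z], which passes to [w]. Both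
    have order [e], so the same powers equal 1. *)
Let transfer N : \sum_i x i = N%:R -> exists2 y : 'I_m -> algC,
  (forall i, (y i == 1) = (x i == 1)) &
  (forall i, `|y i| = 1) /\ \sum_i y i = N%:R.
Proof.
move=> sumx; have [z zprim] := prim_root_exists charK e_gt0.
have [k xk] : exists k : 'I_m -> nat, forall i, x i = z ^+ k i.
  have x_pow i : exists j : 'I_e, x i == z ^+ j.
    by have [j ->] := prim_rootP zprim (xe i); exists j.
  by exists (fun i => nat_of_ord (xchoose (x_pow i))) => i; apply/eqP/(xchooseP (x_pow i)).
have [|w wprim qw] := @prim_root_transfer _ _ _ (\sum_i 'X^(k i) - (Posz N)%:P) charK zprim.
  rewrite rmorphB rmorph_sum /= rootE hornerD hornerN horner_sum map_polyC hornerC /=.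
  rewrite (eq_bigr x) => [|i _]; first by rewrite sumx -pmulrn subrr.
  by rewrite map_polyXn hornerXn -xk.
exists (fun i => w ^+ k i) => [i|].
  by rewrite xk -(prim_order_dvd wprim) -(prim_order_dvd zprim).
split=> [i|].
  rewrite normrX (_ : `|w| = 1) ?expr1n //.
  apply/eqP; rewrite -(@pexpr_eq1 _ _ e) // -normrX prim_expr_order //.
  by rewrite normr1.
apply/eqP; move: qw.
rewrite rmorphB rmorph_sum /= rootE hornerD hornerN horner_sum map_polyC hornerC /=.
rewrite -pmulrn subr_eq0; congr (_ == _).
by apply: eq_bigr => i _; rewrite map_polyXn hornerXn.
Qed.

Lemma sum_unity_roots_le N : \sum_i x i = N%:R -> (N <= m)%N.
Proof.
move=> /transfer[y _ [y1 sumy]]; rewrite -(ler_nat algC) -normr_nat -sumy.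
apply: le_trans (ler_norm_sum _ _ _) _.
by rewrite (eq_bigr (fun=> 1)) ?sumr_const ?card_ord.
Qed.

(** Equality case of the triangle inequality in [algC]. *)
Lemma sum_unity_roots_max : \sum_i x i = m%:R -> forall i, x i = 1.
Proof.
move=> /transfer[y yx [y1 sumy]] i; apply/eqP; rewrite -yx.
have /normC_sum_upper : \sum_i y i = \sum_(i < m) (1 : algC).
  by rewrite sumy sumr_const card_ord.
by move=> -> // j _; rewrite y1.
Qed.

End SumOfRootsOfUnity.

(** The minimal polynomial divides ['X^e - 1], which splits with simple roots in characteristic
    zero. *)
Lemma finite_order_diagonalizable (K : closedFieldType) n (A : 'M[K]_n.+1) e :
  [pchar K] =i pred0 -> (0 < e)%N -> A ^+ e = 1 -> diagonalizable A.
Proof.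
move=> charK e0 Ae; apply/diagonalizableP.
have [r Dp] := closed_field_poly_normal ('X^e - 1 : {poly K}).
rewrite (monicP _) ?monicXnsubC // scale1r in Dp.
exists r.
  rewrite -separable_prod_XsubC -Dp separable_Xn_sub_1 //.
  by rewrite ((pcharf0P K).1 charK) -lt0n.
rewrite -Dp; apply: mxminpoly_min.
by rewrite rmorphB rmorph1 /= rmorphXn /= horner_mx_X Ae subrr.
Qed.

Lemma finite_order_trace (K : closedFieldType) n (A : 'M[K]_n) e :
  [pchar K] =i pred0 -> (0 < e)%N -> A ^+ e = 1%:M ->
  (forall N, \tr A = N%:R -> (N <= n)%N) /\ (\tr A = n%:R -> A = 1%:M).
Proof.
(* Diagonalizability is available for sizes [n.+1]; in size 0 the trace is 0, which forces [N] to be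
   0. *)
move=> charK e0; case: n A => [|n] A Ae.
  rewrite [A]flatmx0 linear0; split=> [N /esym/eqP|_]; last by rewrite [1%:M]flatmx0.
  by rewrite ((pcharf0P K).1 charK) => /eqP->.
have [P Pu /(diagonalizable_forLR Pu)[d DA]] :=
  finite_order_diagonalizable charK e0 Ae.
have Pv : invmx P \in unitmx by rewrite unitmx_inv.
rewrite mxpoly.conjVmx // in DA.
(* Conjugation commutes with powers, so the eigenvalues are roots of unity. *)
have de i : d 0 i ^+ e = 1.
  have : diag_mx d ^+ e = 1.
    have -> : diag_mx d = P *m A *m invmx P.
      by rewrite DA !mulmxA mulmxV // mul1mx mulmxK.
    have -> : (P *m A *m invmx P) ^+ e = P *m A ^+ e *m invmx P.
      elim: (e) => [|k IHk]; first by rewrite !expr0 mulmx1 mulmxV.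
      by rewrite exprS IHk exprS -!mulmxE !mulmxA mulmxKV.
    by rewrite Ae mulmx1 mulmxV.
  have -> : diag_mx d ^+ e = diag_mx (\row_i d 0 i ^+ e).
    elim: (e) => [|k IHk].
      by apply/matrixP => a b; rewrite expr0 !mxE.
    rewrite exprS IHk -mulmxE mulmx_diag; congr diag_mx.
    by apply/rowP => j; rewrite !mxE exprS.
  by move=> /matrixP/(_ i i); rewrite !mxE eqxx mulr1n.
have -> : \tr A = \sum_i d 0 i.
  by rewrite DA mxtrace_mulC mulmxA mulmxV // mul1mx mxtrace_diag.
split=> [N|/(sum_unity_roots_max charK e0 de) d1].
  exact: (sum_unity_roots_le charK e0 de).
rewrite DA (_ : diag_mx d = 1%:M) ?mulmx1 ?mulVmx //.
by rewrite -diag_const_mx; congr diag_mx; apply/rowP => i; rewrite d1 mxE.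
Qed.

(** * A faithful linear representation *)

Section FiniteRankKernel.
Variables (K : fieldType) (X Y : Type) (C : X -> Y -> K).

Let minor m (xs : 'I_m -> X) (ys : 'I_m -> Y) := \matrix_(i, j) C (xs i) (ys j).

(** An invertible minor factors through a space of dimension [N]; the bound ensures that a largest
    one exists. *)
Let minor_rank N (a : X -> 'rV[K]_N) (b : Y -> 'cV[K]_N) m xs ys :
  (forall x y, C x y = (a x *m b y) 0 0) -> @minor m xs ys \in unitmx -> (m <= N)%N.
Proof.
move=> Cab; rewrite -row_full_unit /row_full => /eqP <-.
have -> : minor xs ys = \matrix_i a (xs i) *m \matrix_(k, j) b (ys j) k 0.
  apply/matrixP => i j; rewrite !mxE Cab mxE.
  by apply: eq_bigr => k _; rewrite !mxE.
by apply: leq_trans (mxrankM_maxl _ _) (rank_leq_col _).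
Qed.

Let bordered_minor m (xs : 'I_m -> X) (ys : 'I_m -> Y) x y :
  minor (fun i : 'I_(m + 1) => if split i is inl j then xs j else x)
        (fun i : 'I_(m + 1) => if split i is inl j then ys j else y) =
  block_mx (minor xs ys) (\col_i C (xs i) y) (\row_j C x (ys j)) (C x y)%:M.
Proof.
apply/matrixP => i j; rewrite !mxE.
by case: (split i) => i'; rewrite !mxE; case: (split j) => j';
  rewrite !mxE // !ord1 mulr1n.
Qed.

(* A maximal invertible minor of the infinite matrix [C] determines it: the
   Schur complement of every bordered minor vanishes. *)
Lemma maximal_minor N (a : X -> 'rV[K]_N) (b : Y -> 'cV[K]_N) :
  (forall x y, C x y = (a x *m b y) 0 0) ->
  exists m (xs : 'I_m -> X) (ys : 'I_m -> Y),
    let B := \matrix_(i, j) C (xs i) (ys j) in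
    B \in unitmx /\ forall x y,
      C x y = (\row_j C x (ys j) *m invmx B *m \col_i C (xs i) y) 0 0.
Proof.
move=> Cab.
pose P m := `[< exists (xs : 'I_m -> X) (ys : 'I_m -> Y), minor xs ys \in unitmx >].
have P0 : exists m, P m.
  exists 0%N; apply/asboolP.
  exists (fun i : 'I_0 => match i with Ordinal k lk => False_rect X (notF lk) end).
  exists (fun i : 'I_0 => match i with Ordinal k lk => False_rect Y (notF lk) end).
  by rewrite unitmxE det_mx00 unitr1.
have PN m : P m -> (m <= N)%N by move=> /asboolP[xs [ys /minor_rank]]; exact.
case: (ex_maxnP P0 PN) => m /asboolP[xs [ys Bu]] mmax.
exists m, xs, ys; split=> // x y; set B := (X in invmx X).
set u := (X in X *m invmx _); set v := (X in _ *m invmx _ *m X).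
apply/eqP; rewrite -subr_eq0; apply: contraT => s0.
have : P (m + 1)%N; last by move/mmax; rewrite addn1 ltnn.
apply/asboolP; exists (fun i => if split i is inl j then xs j else x).
exists (fun i => if split i is inl j then ys j else y).
rewrite bordered_minor -/u -/v -[minor xs ys]/B.
(* Block elimination: the determinant of the bordered minor is [\det B] times the Schur complement,
   nonzero by [s0], against maximality. *)
have -> : block_mx B v u (C x y)%:M =
    block_mx 1%:M 0 (u *m invmx B) 1%:M *m
    block_mx B v 0 ((C x y)%:M - u *m invmx B *m v).
  rewrite mulmx_block !mul1mx !mul0mx !addr0 mulmxKV //.
  by congr block_mx; rewrite addrC subrK.
rewrite unitmxE det_mulmx det_lblock det_ublock !det1 !mul1r unitrM.
rewrite -unitmxE Bu det_mx11 unitfE /=.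
by move: s0; rewrite !mxE eqxx.
Qed.

End FiniteRankKernel.

Section RegularFunctions.
Variable K : closedFieldType.

Lemma regular_function_comp n k (T : Type) (phi : T -> affine_space K n)
    (psi : T -> affine_space K k) (f : T -> K) :
  (forall i, regular_function phi (fun t => (psi t : 'rV_k) 0 i)) ->
  regular_function psi f -> regular_function phi f.
Proof.
move=> /choice[q qP] [p pP]; exists (p \mPo [tuple q i | i < k]) => t.
rewrite pP /peval comp_mpoly_meval; apply: meval_eq => i.
by rewrite tnth_mktuple qP.
Qed.

Lemma regular_function_precomp n (T U : Type) (phi : T -> affine_space K n)
    (h : U -> T) (f : T -> K) :
  regular_function phi f -> regular_function (phi \o h) (f \o h).
Proof. by move=> [p pP]; exists p => u /=. Qed.

Section OnVariety.
Variables (n : nat) (T : Type) (phi : T -> affine_space K n).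

Lemma regular_cst c : regular_function phi (fun=> c).
Proof. by exists c%:MP => t; rewrite /peval mevalC. Qed.

Lemma regularZ c f : regular_function phi f -> regular_function phi (fun t => c * f t).
Proof. by move=> [p pf]; exists (c *: p) => t; rewrite /peval mevalZ pf. Qed.

Lemma regular_sum (I : Type) (r : seq I) (F : I -> T -> K) :
  (forall i, regular_function phi (F i)) ->
  regular_function phi (fun t => \sum_(i <- r) F i t).
Proof.
move=> Freg; elim: r => [|i r [p pP]].
  by exists 0 => t; rewrite big_nil /peval meval0.
have [q qP] := Freg i.
by exists (q + p) => t; rewrite big_cons /peval mevalD qP pP.
Qed.

End OnVariety.
End RegularFunctions.

Section AlgebraicGroup.
Variables (K : closedFieldType) (G : affineAlgGroupType K).
Local Notation n := (@adim K G).
Local Notation coord x i := ((@acoord K G x : 'rV[K]_n) 0 i).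

Definition regular_map (T : Type) k (phi : T -> affine_space K k) (h : T -> G) :=
  forall i, regular_function phi (fun t => coord (h t) i).

Lemma regular_map_cst T k (phi : T -> affine_space K k) a : regular_map phi (fun=> a).
Proof. by move=> i; apply: regular_cst. Qed.

Lemma regular_map_mul T k (phi : T -> affine_space K k) (h l : T -> G) :
  regular_map phi h -> regular_map phi l -> regular_map phi (fun t => h t * l t)%g.
Proof.
move=> hr lr i.
apply: (regular_function_comp _
  (regular_function_precomp (fun t => (h t, l t)) (acoord_mul i))) => j.
case: (split_ordP j) => j' ->.
  have [p pP] := hr j'; exists p => t.
  by rewrite /= row_mxEl.
have [p pP] := lr j'; exists p => t.
by rewrite /= row_mxEr.
Qed.

Lemma regular_map_exp T k (phi : T -> affine_space K k) (h : T -> G) d :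
  regular_map phi h -> regular_map phi (fun t => h t ^+ d)%g.
Proof.
move=> hr; elim: d => [|d IHd].
  by under eq_fun do rewrite expg0; apply: regular_map_cst.
by under eq_fun do rewrite expgS; apply: regular_map_mul.
Qed.

(** Each monomial of the multiplication polynomials splits into a factor in [x] and one in [q.1].
    Hence the matrix with rows indexed by [x] and columns by [q] has finite rank. *)
Lemma coord_mul_separated : exists N (a : G -> 'rV[K]_N) (b : G * 'I_n -> 'cV[K]_N),
  forall x q, coord (x * q.1)%g q.2 = (a x *m b q) 0 0.
Proof.
have [p pP] := choice (@acoord_mul K G).
(* A common bound lets one finite set of monomials serve all coordinates. *)
pose D := \max_i msize (p i).
pose I : finType := 'X_{1..(n + n)%N < D}.
pose mon (k : 'I_#|I|) : 'X_{1..(n + n)%N} := bmnm (enum_val k : I).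
exists #|I|.
exists (fun x => \row_k \prod_i coord x i ^+ mon k (lshift n i)).
exists (fun q => \col_k ((p q.2)@_(mon k) *
  \prod_i coord q.1 i ^+ mon k (rshift n i))) => x [y i] /=.
have := pP i (x, y); rewrite /= => ->; rewrite /peval.
have /mpolywE {1}-> : (msize (p i) <= D)%N by apply: leq_bigmax.
rewrite raddf_sum mxE /= (reindex (fun k : 'I_#|I| => enum_val k : I)) /=; last first.
  by apply: onW_bij; apply: enum_val_bij.
apply: eq_bigr => k _; rewrite !mxE mevalZ mevalX big_split_ord /=.
rewrite mulrCA; congr (_ * (_ * _)) => //.
  by apply: eq_bigr => j _; rewrite row_mxEl.
by apply: eq_bigr => j _; rewrite row_mxEr.
Qed.

(** Right translates of the coordinate functions span a finite-dimensional space. The columns of a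
    maximal minor pick a basis, the entries of [row_ x] as functions of [x], and [M z] is the matrix
    of right translation by [z] in it. *)
Theorem faithful_representation : exists m (M : G -> 'M[K]_m),
  [/\ M 1%g = 1%:M, forall x y, M (x * y)%g = M x *m M y, injective M &
      forall T k (phi : T -> affine_space K k) (h : T -> G), regular_map phi h ->
        forall i j, regular_function phi (fun t => M (h t) i j)].
Proof.
have [N [a [b Cab]]] := coord_mul_separated.
have [m [xs [ys []]]] := maximal_minor Cab.
set B := \matrix_(i, j) _ => Bu C_minor.
pose row_ x := \row_j coord (x * (ys j).1)%g (ys j).2.
pose M z := invmx B *m \matrix_(i, j) coord (xs i * z * (ys j).1)%g (ys j).2.
have rowM x z : row_ (x * z)%g = row_ x *m M z.
  apply/rowP => j; rewrite mxE -mulgA.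
  have -> := C_minor x ((z * (ys j).1)%g, (ys j).2).
  rewrite mulmxA !mxE; apply: eq_bigr => i _; rewrite !mxE /= mulgA.
  by congr (_ * _); apply: eq_bigr => l _; rewrite !mxE.
have M1 : M 1%g = 1%:M.
  rewrite /M (_ : \matrix_(i, j) _ = B) ?mulVmx //.
  by apply/matrixP => i j; rewrite !mxE mulg1.
have BM z : B *m M z = \matrix_i row_ (xs i * z)%g.
  by rewrite mulKVmx //; apply/matrixP => i j; rewrite !mxE.
exists m, M; split=> // [x y|x y Mxy|T k phi h hr i j].
(* After multiplication by the invertible [B], multiplicativity becomes [rowM] at the points
   [xs i * x]. *)
- apply: (can_inj (mulKmx Bu)); rewrite BM [RHS]mulmxA BM; apply/row_matrixP => i.
  by rewrite row_mul !rowK mulgA -rowM.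
(* [M z] determines [row_ z], from which the minor formula at [(1, i)] recovers the coordinates of
   [z]. *)
- apply: acoord_inj; apply/rowP => i.
  have rowE z : row_ z = row_ 1%g *m M z by rewrite -rowM mul1g.
  have := C_minor x (1%g, i); have := C_minor y (1%g, i).
  by rewrite /= !mulg1 -/(row_ x) -/(row_ y) (rowE x) (rowE y) Mxy => -> ->.
under eq_fun do rewrite mxE.
apply: regular_sum => l; under eq_fun do rewrite mxE.
apply: regularZ; move: (ys j).2; apply: regular_map_mul; last exact: regular_map_cst.
by apply: regular_map_mul => //; apply: regular_map_cst.
Qed.

End AlgebraicGroup.

(** * Element orders in a periodic component *)

Lemma finite_order_rep_trace (K : closedFieldType) (G : groupType) m
    (M : G -> 'M[K]_m) (x : G) :
  [pchar K] =i pred0 -> M 1%g = 1%:M ->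
  (forall x y, M (x * y)%g = M x *m M y) -> injective M -> finite_order x ->
  (forall N, \tr (M x) = N%:R -> (N <= m)%N) /\ (\tr (M x) = m%:R <-> x = 1%g).
Proof.
move=> charK M1 MM Minj [e /andP[e0 /eqP xe]].
have MX k : M (x ^+ k)%g = M x ^+ k.
  by elim: k => [|k IHk]; rewrite ?expg0 // expgS exprS MM IHk.
have [|le_m tr1] := finite_order_trace charK e0 (A := M x); first by rewrite -MX xe.
split=> //; split=> [/tr1|->]; last by rewrite M1 mxtrace1.
by rewrite -M1 => /Minj.
Qed.

Lemma finite_order_exp (G : groupType) (x : G) d : finite_order x -> finite_order (x ^+ d)%g.
Proof.
move=> [e /andP[e0 /eqP xe]]; exists e.
by rewrite e0 expgnAC xe expg1n eqxx.
Qed.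

Lemma eq_elt_order (G : groupType) (x y : G) : finite_order x -> finite_order y ->
  (forall d, (x ^+ d = 1 <-> y ^+ d = 1)%g) -> elt_order x = elt_order y.
Proof.
move=> fx fy xy; apply/(elt_orderP _ fx).
have [d0 yd dmin] := (elt_orderP _ fy).1 erefl.
by split=> // [|k k0 /xy]; [apply/xy|apply: dmin].
Qed.

Theorem corollary1 (K : closedFieldType) (charK0 : [pchar K]%R =i pred0)
    (G : affineAlgGroupType K) (g : G) :
  let gH := left_coset g (identity_component G) in
  periodic gH -> forall x y : G, gH x -> gH y -> elt_order x = elt_order y.
Proof.
move=> gH per x y gHx gHy.
have [m [M [M1 MM Minj Mreg]]] := faithful_representation G.
have trP z d : gH z -> (\tr (M (z ^+ d)%g) = m%:R <-> (z ^+ d = 1)%g).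
  move=> /per/(finite_order_exp d) fz.
  by case: (finite_order_rep_trace charK0 M1 MM Minj fz).
apply: eq_elt_order; [exact: per|exact: per|move=> d].
suff tr_xy : \tr (M (x ^+ d)%g) = \tr (M (y ^+ d)%g) by rewrite -!trP // tr_xy.
(* With [g] and [d] fixed, the trace is a polynomial in the coordinates of [h], to be studied on the
   identity component. *)
have [f fP] : regular_function (@acoord K G) (fun h => \tr (M ((g * h) ^+ d)%g)).
  apply: regular_sum => i; apply: Mreg; apply: regular_map_exp.
  by apply: regular_map_mul => j; [apply: regular_cst|exists 'X_j => t; rewrite /peval mevalXU].
pose Z := connected_component (range (@acoord K G)) (acoord 1%g).
have clZ : closed Z by apply: component_closed; apply: acoord_closed.
have conZ : connected Z by apply: component_connected.
case: gHx gHy => h Hh <- [h' Hh' <-]; rewrite !fP.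
apply: (connected_bounded_nat_values charK0 clZ conZ _ Hh Hh') => z N Zz.
(* The bound on natural values is [m]: a point of [Z] comes from some [t] in the identity component,
   and periodicity gives [(g * t) ^+ d] finite order. *)
have [t _ tz] := connected_component_sub Zz; rewrite -tz -fP.
have gHt : gH (g * t)%g by exists t => //; rewrite /identity_component /= tz.
have fgt := finite_order_exp d (per _ gHt).
have [le_m _] := finite_order_rep_trace charK0 M1 MM Minj fgt.
exact: le_m.
Qed.
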